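(* Assume that the labeled calibration points $(X_i,Y_i)$, $i=1,\dots,n$, and the test point $(X,Y)$ are i.i.d., and that the unlabeled covariates $X_{n+1},\dots,X_{n+N}$ are i.i.d. with $X_1,\dots,X_n$ and independent of the labeled calibration set. Let $\alpha\in\mathbb{R}$, $\delta\in(0,1)$, let $\mathcal{Q}_{\mathrm{grid}}=(q_1,\dots,q_M)$ be a finite pre-specified ordered grid, and let $\hat q$ be the output of the semi-supervised RCPS procedure for a general loss, run with upper confidence bounds $\hat R^+_{\mathrm{PP}}(q)$ that are valid at level $\delta$ for the mean of the i.i.d. variables $W_1(q),\dots,W_n(q)$. Then $$\mathbb{P}_{D_U^{\mathrm{cal}},D_L^{\mathrm{cal}}}\big(R(\hat q)\le\alpha\big)\ge 1-\delta ,$$ where $R(q)=\mathbb{E}[L(Y,\mathcal{T}_q(X))]$, no monotonicity of $R$ in $q$ is assumed, and no assumption is made on the accuracy of the imputed labels.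
   Context: Setting: features take values in $\mathcal{X}$, responses in $\mathcal{Y}$. For each parameter value $q$, $\mathcal{T}_q$ is a fixed (independent of the calibration data) prediction rule, and $L(y,\mathcal{T}_q(x))$ is a real-valued loss, with all expectations below finite. $D_L^{\mathrm{cal}}=\{(X_i,Y_i)\}_{i=1}^n$ is the labeled and $D_U^{\mathrm{cal}}=\{X_j\}_{j=n+1}^{n+N}$ the unlabeled calibration set, with $N\ge n$. Imputed labels are $\tilde Y_j=g(X_j)$, $j=1,\dots,n+N$, where $g:\mathcal{X}\to\mathcal{Y}$ is a fixed predictive model (arbitrary, not depending on the calibration data). Put $L_i(q)=L(Y_i,\mathcal{T}_q(X_i))$ for $1\le i\le n$ and $\tilde L_j(q)=L(\tilde Y_j,\mathcal{T}_q(X_j))$ for $1\le j\le n+N$. With $m=\lfloor N/n\rfloor$ (so $m=N/n$ when $n$ divides $N$), define for $1\le i\le n$ $$W_i(q)=\frac1m\sum_{j=(i-1)m+n+1}^{im+n}\tilde L_j(q)+L_i(q)-\tilde L_i(q).$$ Upper confidence bound: for each $q\in\mathcal{Q}_{\mathrm{grid}}$, $\hat R^+_{\mathrm{PP}}(q)$ is a real-valued statistic computed from $W_1(q),\dots,W_n(q)$ that is a valid level-$\delta$ upper confidence bound for their common mean: $\mathbb{P}(\mathbb{E}[W_1(q)]\le\hat R^+_{\mathrm{PP}}(q))\ge 1-\delta$. Semi-supervised RCPS procedure for a general loss: go through $q_1,\dots,q_M$ in order; at step $k$, if $\hat R^+_{\mathrm{PP}}(q_k)<\alpha$ set $\hat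 q\leftarrow q_k$ and continue, otherwise stop. Output the current $\hat q$ (the last grid value accepted before the first failure). If the first grid value already fails, no parameter is selected and the event $\{R(\hat q)\le\alpha\}$ is by convention regarded as occurring. $R(\hat q)$ is the deterministic function $R$ evaluated at the data-dependent $\hat q$; the probability is over both calibration sets. *)

(* Defs.v *)
From HB Require Import structures.
From mathcomp Require Import all_boot all_order all_algebra.
From mathcomp Require Import all_classical all_reals all_analysis.

Set Implicit Arguments.
Unset Strict Implicit.
Unset Printing Implicit Defensive.

Import Order.TTheory GRing.Theory Num.Theory.
Import numFieldNormedType.Exports.

Local Open Scope classical_set_scope.
Local Open Scope ring_scope.

Definition mutually_independent d d' (Omega : measurableType d)
    (S : measurableType d') (R : realType) (P : probability Omega R)
    (I : finType) (X : I -> Omega -> S) : Prop :=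
  forall (J : {set I}) (A : I -> set S),
    (forall i, i \in J -> measurable (A i)) ->
    P (\bigcap_(i in [set` J]) X i @^-1` A i) =
    (\prod_(i in J) P (X i @^-1` A i))%E.

Definition identically_distributed d d' (Omega : measurableType d)
    (S : measurableType d') (R : realType) (P : probability Omega R)
    (I : Type) (X : I -> Omega -> S) : Prop :=
  forall (i j : I) (A : set S), measurable A ->
    P (X i @^-1` A) = P (X j @^-1` A).

Definition iid d d' (Omega : measurableType d)
    (S : measurableType d') (R : realType) (P : probability Omega R)
    (I : finType) (X : I -> Omega -> S) : Prop :=
  mutually_independent P X /\ identically_distributed P X.

Definition independent2 d d1 d2 (Omega : measurableType d)
    (S1 : measurableType d1) (S2 : measurableType d2)
    (R : realType) (P : probability Omega R)
    (U : Omega -> S1) (V : Omega -> S2) : Prop :=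
  forall (A : set S1) (B : set S2), measurable A -> measurable B ->
    P (U @^-1` A `&` V @^-1` B) = (P (U @^-1` A) * P (V @^-1` B))%E.

Section losses.
Variables (R : realType) (XX YY Pred Q : Type).
Variables (L : YY -> Pred -> R) (T : Q -> XX -> Pred) (g : XX -> YY).

Definition loss (q : Q) (z : XX * YY) : R := L z.2 (T q z.1).

Definition imputed_loss (q : Q) (x : XX) : R := L (g x) (T q x).

End losses.

Section calibration_data.
Variables (Omega XX YY : Type) (n N : nat).
Variables (DL : 'I_n -> Omega -> XX * YY) (DU : 'I_N -> Omega -> XX).

Definition labeled_and_test (Z : Omega -> XX * YY) (k : option 'I_n) :
    Omega -> XX * YY :=
  if k is Some i then DL i else Z.

Definition covariate (k : 'I_n + 'I_N) : Omega -> XX :=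
  match k with inl i => fst \o DL i | inr j => DU j end.

Definition labeled_set (w : Omega) : n.-tuple (XX * YY) := [tuple DL i w | i < n].

Definition unlabeled_set (w : Omega) : N.-tuple XX := [tuple DU j w | j < N].

End calibration_data.

Section rectified_losses.
Variables (R : realType) (Omega XX YY Pred Q : Type) (n N : nat).
Variables (L : YY -> Pred -> R) (T : Q -> XX -> Pred) (g : XX -> YY).
Variables (DL : 'I_n -> Omega -> XX * YY) (DU : 'I_N -> Omega -> XX).

(* Indices start at 0: [DL i] is the pair number i + 1, [DU j] is the covariate
   X_(n + j + 1); the block of the pair number i + 1 is thus
   i * m <= j < (i + 1) * m. *)
Definition W (q : Q) (i : 'I_n) (w : Omega) : R :=
  let m := (N %/ n)%N in
  m%:R^-1 * (\sum_(j < N | (i * m <= j < i.+1 * m)%N)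
               imputed_loss L T g q (DU j w))
  + loss L T q (DL i w) - imputed_loss L T g q (DL i w).1.

Definition W_sample (q : Q) (w : Omega) : n.-tuple R := [tuple W q i w | i < n].

End rectified_losses.

Section rcps_procedure.
Variables (R : realType) (Q : Type) (ub : Q -> R) (alpha : R).

Fixpoint rcps_from (current : option Q) (grid : seq Q) : option Q :=
  if grid is q :: grid' then
    if ub q < alpha then rcps_from (Some q) grid' else current
  else current.

(* [None]: no parameter is selected. *)
Definition rcps (grid : seq Q) : option Q := rcps_from None grid.

End rcps_procedure.

Definition risk d (Omega : measurableType d) (R : realType)
    (P : probability Omega R) (XX YY Pred Q : Type)
    (L : YY -> Pred -> R) (T : Q -> XX -> Pred) (Z : Omega -> XX * YY)
    (q : Q) : \bar R :=
  ('E_P[loss L T q \o Z])%E.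

(* Main.v *)
(** Since the imputed losses of all covariates share one mean, they cancel in
    expectation and E[W_1(q)] = R(q) whatever the imputation [g]. Let q_k be the
    first grid value with R(q_k) > alpha; if there is none, nothing is to be
    proved. When the confidence bound at this single deterministic q_k is valid,
    it is at least alpha, so the procedure stops at or before q_k and outputs a
    value preceding q_k. This event has probability at least 1 - delta, so
    neither a union bound over the grid nor monotonicity of R is needed. *)
Require Import Defs.
From HB Require Import structures.
From mathcomp Require Import all_boot all_order all_algebra.
From mathcomp Require Import all_classical all_reals all_analysis.
From mathcomp Require Import measurable_realfun.

Import Order.TTheory GRing.Theory Num.Theory.
Import numFieldNormedType.Exports.

Local Open Scope classical_set_scope.
Local Open Scope ring_scope.

(** Both expectations are integrals of [f] against the law of the variable, and the two laws agree.
    The same change of variables for [|f|] carries integrability from [X] over to [Y]. *)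
Lemma expectation_same_law (R : realType) d d' (Omega : measurableType d)
    (S : measurableType d') (P : probability Omega R) (X Y : Omega -> S)
    (f : S -> R) :
  measurable_fun [set: Omega] X -> measurable_fun [set: Omega] Y ->
  measurable_fun [set: S] f ->
  (forall A, measurable A -> P (X @^-1` A) = P (Y @^-1` A)) ->
  f \o X \in Lfun P 1 ->
  f \o Y \in Lfun P 1 /\ ('E_P[f \o Y] = 'E_P[f \o X])%E.
Proof.
move=> mX mY mf XY /Lfun1_integrable fX.
pose X' : {RV P >-> S} := HB.pack X (isMeasurableFun.Build _ _ _ _ X mX).
pose Y' : {RV P >-> S} := HB.pack Y (isMeasurableFun.Build _ _ _ _ Y mY).
have mEf : measurable_fun [set: S] (EFin \o f) by exact/measurable_EFinP.
have same h : (\int[distribution P X']_y h y = \int[distribution P Y']_y h y)%E.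
  by apply: eq_measure_integral => A mA _; exact: XY.
have fY : P.-integrable [set: Omega] (EFin \o (f \o Y)).
  apply/integrableP; split.
    by apply/measurable_EFinP; exact: measurableT_comp.
  have /integrableP[_] := fX; apply: le_lt_trans.
  have mabs : measurable_fun [set: S] (abse \o (EFin \o f)).
    exact: measurableT_comp.
  rewrite le_eqVlt; apply/orP; left; apply/eqP.
  have int_abs (V : {RV P >-> S}) :=
    ge0_integral_distribution V mabs (fun y => abse_ge0 (f y)%:E).
  by apply: etrans (int_abs X'); rewrite same; exact: esym (int_abs Y').
split; first exact/Lfun1_integrable.
by rewrite unlock -(integral_distribution (X := X') mEf fX)
  -(integral_distribution (X := Y') mEf fY) same.
Qed.

Arguments expectation_same_law {R d d' Omega S P X Y f}.

Lemma expectation_sum_ord (R : realType) d (Omega : measurableType d)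
    (P : probability Omega R) (n : nat) (p : pred 'I_n)
    (X : 'I_n -> Omega -> R) :
  (forall i, X i \in Lfun P 1) ->
  \sum_(i < n | p i) X i \in Lfun P 1 /\
  ('E_P[\sum_(i < n | p i) X i]%R = \sum_(i < n | p i) 'E_P[X i])%E.
Proof.
move=> intX; split; first by rewrite rpred_sum.
rewrite -big_filter -(big_map X predT id) expectation_sum.
  by rewrite big_map big_filter.
by move=> _ /mapP[i _ ->].
Qed.

(** By linearity, the equal laws of the covariates make the block average and the subtracted term
    cancel, and the equal laws of the labeled and test pairs identify what remains. *)
Lemma expectation_W0 (R : realType) d dX dY (Omega : measurableType d)
    (P : probability Omega R) (XX : measurableType dX) (YY : measurableType dY)
    (Pred Q : Type) (L : YY -> Pred -> R) (T : Q -> XX -> Pred) (g : XX -> YY)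
    (n N : nat) (n_gt0 : (0 < n)%N) (le_nN : (n <= N)%N)
    (DL : 'I_n -> {RV P >-> (XX * YY)%type}) (Z : {RV P >-> (XX * YY)%type})
    (DU : 'I_N -> {RV P >-> XX}) (q : Q) :
  identically_distributed P (labeled_and_test DL Z) ->
  identically_distributed P (covariate DL DU) ->
  measurable_fun [set: XX * YY] (loss L T q) ->
  measurable_fun [set: XX] (imputed_loss L T g q) ->
  P.-integrable [set: Omega] (EFin \o (loss L T q \o Z)) ->
  (forall k, P.-integrable [set: Omega]
     (EFin \o (imputed_loss L T g q \o covariate DL DU k))) ->
  ('E_P[W L T g DL DU q (Ordinal n_gt0)] = risk P L T Z q)%E.
Proof.
move=> idL idX mL mI /Lfun1_integrable intL intI.
set i0 := Ordinal n_gt0.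
pose m := (N %/ n)%N.
pose I := imputed_loss L T g q.
(* [n <= N] makes the block size positive, so [m%:R^-1] is a true inverse and not the default value
   0. *)
have m_gt0 : (0 < m)%N by rewrite divn_gt0.
have le_mN : (m <= N)%N by exact: leq_div.
have intU j : I \o DU j \in Lfun P 1.
  by apply/Lfun1_integrable; exact: (intI (inr j)).
have intI0 : I \o (fst \o DL i0) \in Lfun P 1.
  by apply/Lfun1_integrable; exact: (intI (inl i0)).
have EU j : ('E_P[I \o DU j] = 'E_P[I \o (fst \o DL i0)])%E.
  have mX0 : measurable_fun [set: Omega] (fst \o DL i0).
    exact: measurableT_comp.
  have mXj : measurable_fun [set: Omega] (DU j) by [].
  have [|_ ->//] := expectation_same_law mX0 mXj mI _ intI0.
  by move=> A mA; exact: (idX (inl i0) (inr j)).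
have [intL0 EL0] : loss L T q \o DL i0 \in Lfun P 1 /\
    ('E_P[loss L T q \o DL i0] = 'E_P[loss L T q \o Z])%E.
  apply: expectation_same_law => // A mA.
  exact: (idL None (Some i0)).
(* The block of the first pair, [0 * m <= j < 1 * m], is just [j < m]. *)
have [intS ES] := expectation_sum_ord _ _ _ P _ (fun j : 'I_N => (j < m)%N) _ intU.
pose S := \sum_(j < N | (j < m)%N) (I \o DU j).
have -> : W L T g DL DU q i0 =
    (m%:R^-1 \o* S \+ (loss L T q \o DL i0)) \- (I \o (fst \o DL i0)).
  by apply/funext => w; rewrite /W -/m mul1n /= /S fct_sumE mulrC.
have intmS : m%:R^-1 \o* S \in Lfun P 1.
  rewrite (_ : _ \o* _ = m%:R^-1 *: S); last by apply/funext => v; exact: mulrC.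
  exact: rpredZ.
rewrite expectationB ?expectationD ?expectationZl //; last first.
  by rewrite rpredD.
rewrite /S ES (eq_bigr _ (fun j _ => EU j)).
rewrite -(big_ord_widen N (fun=> 'E_P[I \o (fst \o DL i0)])%E le_mN).
(* The common mean is finite, so the computation moves from [\bar R] to [R], where the [m] equal
   terms cancel against [m%:R^-1]. *)
have /fineK <- := expectation_fin_num intI0.
rewrite sumEFin sumr_const card_ord -EFinM -[fine _ *+ m]mulr_natl mulKf ?pnatr_eq0 -?lt0n//.
rewrite EL0 /risk.
have /fineK <- := expectation_fin_num intL.
by rewrite -!EFinD addrAC subrr add0r.
Qed.

Arguments expectation_W0 {R d dX dY Omega P XX YY Pred Q L T g n N n_gt0} le_nN
  {DL Z DU q}.

Lemma measurable_set_of_Prop d (Omega : measurableType d) (A : Prop) :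
  measurable [set _ : Omega | A].
Proof.
have [a|na] := pselect A.
  by rewrite (_ : [set _ | A] = setT) //; apply/seteqP; split.
by rewrite (_ : [set _ | A] = set0) //; apply/seteqP; split.
Qed.

Section rcps.
Variables (R : realType) (Q : Type) (alpha : R) (good : Q -> Prop).

(** The blocking index is the first bad one, fixed by [s] and [good] before [ub] is quantified;
    hence it does not vary with the data. The invariant is that the current value is good. Indices
    replace grid values because the assumptions on the bounds are stated per grid position. *)
Lemma rcps_from_good_or_blocked (I : Type) (q : I -> Q) (s : seq I)
    (current : option Q) :
  (forall q', current = Some q' -> good q') ->
  (forall ub : Q -> R, forall q', rcps_from ub alpha current (map q s) = Some q' ->
     good q') \/
  exists i, ~ good (q i) /\ forall ub : Q -> R, alpha <= ub (q i) ->
    forall q', rcps_from ub alpha current (map q s) = Some q' -> good q'.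
Proof.
elim: s current => [|i s IHs] current curG /=; first by left.
have [Gi|nGi] := pselect (good (q i)).
  have [|allG|[j [nGj blocked]]] := IHs (Some (q i)); first by move=> _ [<-].
    by left => ub; case: ifP => // _; exact: allG.
  by right; exists j; split=> // ub leub; case: ifP => // _; exact: blocked.
(* The head is bad: since the test is strict, [alpha <= ub (q i)] makes it fail, and the good
   current value is returned. *)
by right; exists i; split=> // ub; rewrite leNgt => /negbTE ->.
Qed.

(** [Q] carries no sigma-algebra, so the event is built along the grid from the sets where
    [ub w (q i) < alpha]; once the procedure stops, the output no longer depends on [w]. *)
Lemma measurable_rcps_from_good d (Omega : measurableType d)
    (ub : Omega -> Q -> R) (I : Type) (q : I -> Q) (s : seq I)
    (current : option Q) :
  (forall i, measurable_fun [set: Omega] (fun w => ub w (q i))) ->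
  measurable [set w | forall q',
    rcps_from (ub w) alpha current (map q s) = Some q' -> good q'].
Proof.
move=> mub; elim: s current => [|i s IHs] current /=.
  exact: measurable_set_of_Prop.
set A := [set w | ub w (q i) < alpha].
have mA : measurable A.
  have := mub i measurableT _ (measurable_itv `]-oo, alpha[).
  by rewrite setTI preimage_itvNyo.
rewrite [X in measurable X](_ : _ = (A `&` [set w | forall q',
    rcps_from (ub w) alpha (Some (q i)) (map q s) = Some q' -> good q'])
  `|` (~` A `&` [set w | forall q', current = Some q' -> good q'])); last first.
  apply/seteqP; split=> w /=.
    case: ifP => [lt_ub|/negbT ge_ub]; [by left|right].
    by split=> //; exact/negP.
  by move=> [[-> //]|[/negP/negbTE -> //]].
apply: measurableU; apply: measurableI => //; first exact: measurableC.
exact: measurable_set_of_Prop.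
Qed.

End rcps.

Theorem proposition1 (R : realType) (d dX dY : measure_display)
    (Omega : measurableType d) (P : probability Omega R)
    (XX : measurableType dX) (YY : measurableType dY) (Pred Q : Type)
    (L : YY -> Pred -> R) (T : Q -> XX -> Pred) (g : XX -> YY)
    (n N : nat) (n_gt0 : (0 < n)%N) (le_nN : (n <= N)%N)
    (* labeled pairs, test point, unlabeled covariates *)
    (DL : 'I_n -> {RV P >-> (XX * YY)%type}) (Z : {RV P >-> (XX * YY)%type})
    (DU : 'I_N -> {RV P >-> XX})
    (iid_labeled_test : iid P (labeled_and_test DL Z))
    (iid_covariates : iid P (covariate DL DU))
    (indep_sets : independent2 P (labeled_set DL) (unlabeled_set DU))
    (loss_meas : forall q, measurable_fun [set: XX * YY] (loss L T q))
    (imputed_meas : forall q, measurable_fun [set: XX] (imputed_loss L T g q))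
    (loss_int : forall q,
       P.-integrable [set: Omega] (EFin \o (loss L T q \o Z)))
    (imputed_int : forall q k,
       P.-integrable [set: Omega]
         (EFin \o (imputed_loss L T g q \o covariate DL DU k)))
    (alpha delta : R) (delta_01 : 0 < delta < 1)
    (M : nat) (grid : M.-tuple Q)
    (ucb : Q -> n.-tuple R -> R)
    (ucb_meas : forall k : 'I_M,
       measurable_fun [set: n.-tuple R] (ucb (tnth grid k)))
    (ucb_valid : forall k : 'I_M,
       let q := tnth grid k in
       ((1 - delta)%:E <=
        P [set w | 'E_P[W L T g DL DU q (Ordinal n_gt0)] <=
                   (ucb q (W_sample L T g DL DU q w))%:E])%E) :
  let qhat w := rcps (fun q => ucb q (W_sample L T g DL DU q w)) alpha grid in
  ((1 - delta)%:E <=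
   P [set w | forall q, qhat w = Some q -> risk P L T Z q <= alpha%:E])%E.
Proof.
pose good q := (risk P L T Z q <= alpha%:E)%E.
pose qhat w := rcps (fun q => ucb q (W_sample L T g DL DU q w)) alpha grid.
change ((1 - delta)%:E <=
  P [set w | forall q, qhat w = Some q -> good q])%E.
have [_ idL] := iid_labeled_test; have [_ idX] := iid_covariates.
have mW q i : measurable_fun [set: Omega] (W L T g DL DU q i).
  have mI (V : Omega -> XX) : measurable_fun [set: Omega] V ->
      measurable_fun [set: Omega] (imputed_loss L T g q \o V).
    exact: measurableT_comp.
  apply: measurable_funB; last first.
    by apply: (mI (fst \o DL i)); exact: measurableT_comp.
  apply: measurable_funD; last exact: measurableT_comp.
  apply: measurable_funM => //; under eq_fun do rewrite -big_filter.
  by apply: measurable_sum => j; exact: mI.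
have mub k : measurable_fun [set: Omega]
    (fun w => ucb (tnth grid k) (W_sample L T g DL DU (tnth grid k) w)).
  apply: (measurableT_comp (ucb_meas k)).
  apply/measurable_fun_tnthP => i.
  rewrite (_ : _ \o _ = W L T g DL DU (tnth grid k) i)//.
  by apply/funext => w; rewrite /= tnth_mktuple.
have mgood : measurable [set w | forall q, qhat w = Some q -> good q].
  rewrite /qhat -(map_tnth_enum grid).
  exact: (measurable_rcps_from_good _ _ _ _ _ _
    (fun w q => ucb q (W_sample L T g DL DU q w))).
have [//|allG|[k [badk blocked]]] :=
    @rcps_from_good_or_blocked _ _ alpha good _ (tnth grid) (enum 'I_M) None.
  (* Without a bad grid value the event is certain, and [1 - delta <= 1]. *)
  rewrite [X in P X](_ : _ = setT) ?probability_setT ?lee_fin.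
    by rewrite gerBl ltW//; case/andP: delta_01.
  rewrite -subTset => w _ q.
  by rewrite /qhat -(map_tnth_enum grid); exact: allG.
(* The event that the bound is valid at the blocking index is contained in the target event. *)
apply: le_trans (ucb_valid k) _; apply: le_measure; rewrite ?inE //.
  rewrite -[X in measurable X]setTI.
  by apply: measurable_lee => //; exact/measurable_EFinP.
(* On that event [alpha < risk <= ucb] at index [k], so the test fails there at the latest. *)
move=> w /=; rewrite (expectation_W0 le_nN idL idX)// => le_risk q.
rewrite /qhat -(map_tnth_enum grid); apply: blocked.
rewrite -lee_fin; apply: le_trans le_risk.
by apply: ltW; rewrite ltNge; apply/negP.
Qed.
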